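(* Let $q\ge1$, let $F\colon X\rightrightarrows Y$ be a set-valued mapping between Banach spaces, and let $g\colon X\to Y$ be $C^1$-smooth around $\bar x\in X$. Assume that the mapping $G\colon x\mapsto g(\bar x)+\nabla g(\bar x)(x-\bar x)+F(x)$ is strongly metrically $q$-subregular at $(\bar x,\bar y)$ with $\bar y\in G(\bar x)$. Then for any $\lambda>\mathrm{ssubreg}^qG(\bar x,\bar y)$ there exists $\gamma>0$ such that for every $u\in\mathbb{B}(\bar x,\gamma)$ the mapping $$x\mapsto G(u,x):=g(\bar x)+\nabla g(u)(x-\bar x)+F(x)$$ is strongly metrically $q$-subregular at $(\bar x,\bar y)$ with modulus $\lambda$; i.e., there is $\eta>0$ for which $$\|x-\bar x\|\le\lambda\,\big[d\big(\bar y;G(u,x)\big)\big]^q\quad\text{whenever }x\in\mathbb{B}(\bar x,\eta).$$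
   Context: $\mathbb{B}(x,r)$ is the closed ball of center $x$ and radius $r$; $d(y;\Omega)=\inf_{w\in\Omega}\|y-w\|$, with $d(y;\emptyset)=\infty$; $\mathrm{gph}\,F=\{(x,y):y\in F(x)\}$. A set-valued mapping $F\colon X\rightrightarrows Y$ with $(\bar x,\bar y)\in\mathrm{gph}\,F$ is strongly metrically $q$-subregular at $(\bar x,\bar y)$ if there are $\eta,\gamma>0$ such that $$\|x-\bar x\|\le\eta\,\big[d\big(\bar y;F(x)\big)\big]^q\quad\text{for all }x\in\mathbb{B}(\bar x,\gamma).$$ Any such $\eta$ is called a modulus. The exact strong $q$-subregularity bound $\mathrm{ssubreg}^qF(\bar x,\bar y)$ is the infimum of all $\eta>0$ for which this holds with some $\gamma>0$; the superscript $q$ in $\mathrm{ssubreg}^q$ is a label, not a power. *)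

(* Defs.v *)
From mathcomp Require Import all_boot all_order all_algebra.
From mathcomp Require Import all_classical all_reals all_analysis.
Set Implicit Arguments.
Unset Strict Implicit.
Unset Printing Implicit Defensive.
Import Order.TTheory GRing.Theory Num.Theory.
Import numFieldNormedType.Exports.
Local Open Scope classical_set_scope.
Local Open Scope ring_scope.

(* A set-valued mapping X ⇉ Y is a function F : X -> set Y. *)

(* Extended-real valued, so that the distance to the empty set is +oo. *)
Definition dist (R : realType) (Y : normedModType R) (y : Y) (A : set Y)
  : \bar R := ereal_inf [set (`|y - w|)%:E | w in A].

Definition graph (X Y : Type) (F : X -> set Y) : set (X * Y) :=
  [set p | F p.1 p.2].

(* For 0 < q the power [poweR] sends +oo to +oo, so for 0 < eta the inequality
   holds trivially at the points x with F x = set0. *)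
Definition ssubreg_on_ball (R : realType) (X Y : normedModType R) (q : R)
    (F : X -> set Y) (xbar : X) (ybar : Y) (eta gamma : R) : Prop :=
  forall x, closed_ball xbar gamma x ->
    ((`|x - xbar|)%:E <= eta%:E * dist ybar (F x) `^ q)%E.

Definition is_ssubreg_modulus (R : realType) (X Y : normedModType R) (q : R)
    (F : X -> set Y) (xbar : X) (ybar : Y) (eta : R) : Prop :=
  0 < eta /\
  exists gamma : R, 0 < gamma /\ ssubreg_on_ball q F xbar ybar eta gamma.

Definition strongly_subregular_with (R : realType) (X Y : normedModType R)
    (q : R) (F : X -> set Y) (xbar : X) (ybar : Y) (eta : R) : Prop :=
  graph F (xbar, ybar) /\ is_ssubreg_modulus q F xbar ybar eta.

Definition strongly_subregular (R : realType) (X Y : normedModType R) (q : R)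
    (F : X -> set Y) (xbar : X) (ybar : Y) : Prop :=
  exists eta : R, strongly_subregular_with q F xbar ybar eta.

Definition ssubreg (R : realType) (X Y : normedModType R) (q : R)
    (F : X -> set Y) (xbar : X) (ybar : Y) : \bar R :=
  ereal_inf [set eta%:E | eta in is_ssubreg_modulus q F xbar ybar].

Definition opnorm (R : realType) (X Y : normedModType R) (A : X -> Y)
  : \bar R := ereal_sup [set (`|A h|)%:E | h in [set h : X | `|h| <= 1]].

(* Frechet differentiable on a neighborhood of xbar, with a derivative that is
   continuous there for the operator norm. *)
Definition C1_around (R : realType) (X Y : normedModType R) (g : X -> Y)
    (xbar : X) : Prop :=
  \forall u \near xbar, differentiable g u /\
    opnorm (fun h => 'd g v h - 'd g u h) @[v --> u] --> 0%E.

(* x |-> g(xbar) + Dg(u)(x - xbar) + F(x); only meaningful where g is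
   differentiable at u. *)
Definition linearized (R : realType) (X Y : normedModType R) (g : X -> Y)
    (F : X -> set Y) (xbar u : X) : X -> set Y :=
  fun x => [set g xbar + 'd g u (x - xbar) + w | w in F x].

(* Main.v *)
Require Import Defs.
From mathcomp Require Import all_boot all_order all_algebra.
From mathcomp Require Import all_classical all_reals all_analysis.
From mathcomp Require Import lra.
Set Implicit Arguments.
Unset Strict Implicit.
Unset Printing Implicit Defensive.
Import Order.TTheory GRing.Theory Num.Theory.
Import numFieldNormedType.Exports.
Local Open Scope classical_set_scope.
Local Open Scope ring_scope.

(** Since [lambda] exceeds the infimum of the moduli, some modulus [mu < lambda] works for the
    linearization at [xbar]. Taking [q]-th roots makes the estimate linear in the distance: with
    [r = |x - xbar|], each residual [d] at [xbar] satisfies [mu^(-1/q) r^(1/q) <= d]. Replacing the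
    derivative at [xbar] by that at [u] changes a residual by at most [e r], where [e] bounds the
    operator norm of the difference, and [r <= r^(1/q)] when [r <= 1]. So the loss is absorbed as
    soon as [e] is at most [mu^(-1/q) - lambda^(-1/q)] ([le_mul_powR_perturb]). [le_mul_dist_poweR]
    lets this be done pointwise in the values of [F]. *)

Lemma powR_invK (R : realType) (q a : R) :
  0 < q -> 0 <= a -> (a `^ q^-1) `^ q = a.
Proof. by move=> q0 a0; rewrite -powRrM mulVf ?gt_eqF// powRr1. Qed.

Lemma powRK_inv (R : realType) (q a : R) :
  0 < q -> 0 <= a -> (a `^ q) `^ q^-1 = a.
Proof. by move=> q0 a0; rewrite -powRrM divff ?gt_eqF// powRr1. Qed.

Lemma le_mul_powR (R : realType) (q eta r t : R) :
  0 < q -> 0 < eta -> 0 <= r -> 0 <= t ->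
  (r <= eta * t `^ q) = (r `^ q^-1 <= eta `^ q^-1 * t).
Proof.
move=> q0 eta0 r0 t0; have qV0 : 0 <= q^-1 by rewrite invr_ge0 ltW.
apply/idP/idP => h.
- rewrite -[t in leRHS](powRK_inv q0)// -powRM ?powR_ge0 ?(ltW eta0)//.
  by apply: ge0_ler_powR; rewrite // nnegrE// mulr_ge0 ?powR_ge0 ?(ltW eta0).
- rewrite -(powR_invK q0 r0) -[eta](powR_invK q0) ?(ltW eta0)//.
  rewrite -powRM ?powR_ge0//.
  by apply: ge0_ler_powR; rewrite ?(ltW q0)// nnegrE// ?mulr_ge0 ?powR_ge0.
Qed.

(** Trades the extended-real distance for real inequalities, one per point of [A]; for empty [A]
    both sides hold, the distance being [+oo]. *)
Lemma le_mul_dist_poweR (R : realType) (Y : normedModType R) (q eta r : R)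
    (y : Y) (A : set Y) : 0 < q -> 0 < eta -> 0 <= r ->
  (r%:E <= eta%:E * dist y A `^ q)%E <->
  (forall w, A w -> r <= eta * `|y - w| `^ q).
Proof.
move=> q0 eta0 r0.
have dist0 : (0 <= dist y A)%E.
  by apply/ereal_infP => _ [w _ <-]; rewrite lee_fin.
split=> [h w Aw|h].
- rewrite -lee_fin (le_trans h)// EFinM -poweR_EFin lee_pmul2l ?lte_fin//.
  apply: gt0_ler_poweR; rewrite ?(ltW q0)// ?in_itv/= ?leey ?andbT//.
  by apply: ge_ereal_inf; exists (`|y - w|)%:E => //; exists w.
(* The [q]-th root of [s] bounds every distance from below, hence their infimum; no nearest point is
   required. *)
- set s : R := r / eta.
  have s0 : 0 <= s by rewrite divr_ge0// ltW.
  have sd : ((s `^ q^-1)%:E <= dist y A)%E.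
    apply/ereal_infP => _ [w Aw <-]; rewrite lee_fin.
    have := le_mul_powR q0 ltr01 s0 (normr_ge0 (y - w)).
    by rewrite powR1 !mul1r => <-; rewrite /s ler_pdivrMr// mulrC h.
  have -> : r = eta * s by rewrite /s mulrC divfK// gt_eqF.
  rewrite EFinM lee_pmul2l ?lte_fin// -(powR_invK q0 s0) -poweR_EFin.
  apply: gt0_ler_poweR; rewrite ?(ltW q0)// in_itv/= leey ?andbT//.
  by rewrite lee_fin powR_ge0.
Qed.

(* The size of the tolerated perturbation comes from taking [q]-th roots:
   [r `^ q^-1 <= mu `^ q^-1 * d], and [r <= r `^ q^-1] since [r <= 1 <= q]. *)
Lemma le_mul_powR_perturb (R : realType) (q mu lambda r d t : R) :
  1 <= q -> 0 < mu -> mu <= lambda -> 0 <= r <= 1 -> 0 <= d -> 0 <= t ->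
  r <= mu * d `^ q ->
  d <= t + ((mu `^ q^-1)^-1 - (lambda `^ q^-1)^-1) * r ->
  r <= lambda * t `^ q.
Proof.
move=> q1 mu0 mul /andP[r0 r1] d0 t0.
have q0 : 0 < q by exact: lt_le_trans q1.
have l0 : 0 < lambda by exact: lt_le_trans mul.
rewrite !le_mul_powR//.
have m0 : 0 < mu `^ q^-1 by exact: powR_gt0.
have n0 : 0 < lambda `^ q^-1 by exact: powR_gt0.
have mn : mu `^ q^-1 <= lambda `^ q^-1.
  by apply: ge0_ler_powR; rewrite ?nnegrE ?invr_ge0 ?(ltW q0) ?(ltW mu0) ?(ltW l0).
have rp : r <= r `^ q^-1.
  have [->|rN0] := eqVneq r 0; first exact: powR_ge0.
  by apply: ger1_powR; rewrite ?invf_le1// lt_neqAle eq_sym rN0 r0.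
rewrite -ler_pdivrMl// => rd dt; rewrite -ler_pdivrMl//.
have e0 : 0 <= (mu `^ q^-1)^-1 - (lambda `^ q^-1)^-1.
  by rewrite subr_ge0 lef_pV2.
have := ler_wpM2l e0 rp.
move: rd dt; rewrite !mulrBl; lra.
Qed.

Lemma le_opnorm (R : realType) (X Y : normedModType R) (A : {linear X -> Y})
    (e : R) (h : X) : (opnorm A <= e%:E)%E -> `|A h| <= e * `|h|.
Proof.
move=> Ae; have [->|h0] := eqVneq h 0; first by rewrite linear0 !normr0 mulr0.
have nh : 0 < `|h| by rewrite normr_gt0.
have /le_trans/(_ Ae) : ((`|A (`|h|^-1 *: h)|)%:E <= opnorm A)%E.
  apply: ereal_sup_ubound; exists (`|h|^-1 *: h) => //=.
  by rewrite normrZ normfV normr_id mulVf// gt_eqF.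
by rewrite lee_fin linearZ/= normrZ normfV normr_id ler_pdivrMl// mulrC.
Qed.

Theorem theorem4p4 (R : realType) (X Y : completeNormedModType R) (q : R)
    (F : X -> set Y) (g : X -> Y) (xbar : X) (ybar : Y)
    (hq : 1 <= q)
    (hg : C1_around g xbar)
    (hG : strongly_subregular q (linearized g F xbar xbar) xbar ybar)
    (lambda : R)
    (hlambda : (ssubreg q (linearized g F xbar xbar) xbar ybar < lambda%:E)%E) :
  exists gamma : R, 0 < gamma /\
    forall u : X, closed_ball xbar gamma u ->
      strongly_subregular_with q (linearized g F xbar u) xbar ybar lambda.
Proof.
have q0 : 0 < q by exact: lt_le_trans hq.
have [_ [hgraph _]] := hG.
have /ereal_inf_ltP[_ [mu [mu0 [gm [gm0 Hmu]]] <-]] := hlambda.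
rewrite lte_fin => mul.
have l0 : 0 < lambda by exact: lt_trans mul.
(* The slack between the two rooted moduli, positive because [mu < lambda]. *)
pose e := (mu `^ q^-1)^-1 - (lambda `^ q^-1)^-1.
have e0 : 0 < e.
  rewrite subr_gt0 ltf_pV2 ?posrE ?powR_gt0//.
  by apply: gt0_ltr_powR; rewrite ?invr_gt0// nnegrE ltW.
have [_ dgc] := nbhs_singleton hg.
have /nbhs_closedballP[gamma Hgamma] : \forall u \near xbar,
    (opnorm (fun h => 'd g u h - 'd g xbar h)%R < e%:E)%E.
  apply: (dgc [set y | (y < e%:E)%E]).
  by apply: open_nbhs_nbhs; split; [exact: open_ereal_lt_ereal|rewrite /= lte_fin].
exists gamma%:num; split => // u /Hgamma /= /ltW ue.
split.
  (* At [x = xbar] the linear terms vanish, so the same [w] serves for every [u]. *)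
  case: hgraph => w Fw /= <-; exists w => //.
  by rewrite /= subrr !linear0.
(* The cap by 1 ensures [r <= 1], which gives [r <= r^(1/q)]. *)
split => //; exists (Num.min gm 1); split; first by rewrite lt_min gm0 ltr01.
move=> x xball; apply/le_mul_dist_poweR => // _ [w Fw <-].
have xgm : closed_ball xbar gm x.
  by apply: le_closed_ball xball; rewrite ge_min lexx.
have x1 : `|x - xbar| <= 1.
  have : closed_ball xbar 1 x.
    by apply: le_closed_ball xball; rewrite ge_min lexx orbT.
  by rewrite closed_ballE// /closed_ball_/= distrC.
have /le_mul_dist_poweR -/(_ q0 mu0 (normr_ge0 _)) Hx := Hmu x xgm.
(* Compare the residuals at [u] and at [xbar] built from the same [w]. *)
have := Hx _ (ex_intro2 _ _ w Fw erefl).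
move/(le_mul_powR_perturb hq mu0 (ltW mul)); apply; rewrite ?normr_ge0//.
pose A : {linear X -> Y} := 'd g u \- 'd g xbar.
have Ae := @le_opnorm _ _ _ A e (x - xbar) ue.
(* The two residuals differ by [A (x - xbar)], so the triangle inequality concludes. *)
apply: (le_trans _ (lerD (lexx _) Ae)); apply: le_trans (ler_normD _ _).
set a := 'd g xbar _; set b := 'd g u _.
suff -> : ybar - (g xbar + a + w) = ybar - (g xbar + b + w) + (b - a) by [].
by rewrite ![g xbar + _ + w]addrAC !opprD !addrA addrNK.
Qed.
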